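(* Let $\ell>3$ be a prime. Let $\Omega$ and $G$ be both abstract (resp. both profinite) groups, let $\varphi\in\mathrm{Hom}(G,\mathrm{Aut}(\Omega))$ be a group action, and assume that $\Omega$ and $G$ act trivially on $\mathbb{Z}/\ell$. Suppose $\bar{\chi}_1,\bar{\chi}_2,\bar{\chi}_3\in \mathrm{Hom}(\Omega,\mathbb{Z}/\ell)$ are characters satisfying the following three conditions: (i) the triple Massey product $\langle\bar{\chi}_1,\bar{\chi}_2,\bar{\chi}_3\rangle$ is not empty and contains $0$; (ii) none of the $\bar{\chi}_i$ are zero and one of the two sets $\{\bar{\chi}_1,\bar{\chi}_2\}$ or $\{\bar{\chi}_2,\bar{\chi}_3\}$ is $(\mathbb{Z}/\ell)$-linearly independent; (iii) there exist $\Phi\in G(3,\ell)$ and $\omega_0\in\Omega$ such that $$\bar{\chi}_1(\omega_0)=\bar{\chi}_2(\omega_0)=\bar{\chi}_3(\omega_0)=0\quad\mbox{and}\quad h_\ell(\tau_{3,\ell}(\Phi)(\omega_0))\ne 0.$$ If there exist characters $\chi_1,\chi_2,\chi_3\in\mathrm{Hom}(\Omega\rtimes_\varphi G,\mathbb{Z}/\ell)$ extending $\bar{\chi}_1,\bar{\chi}_2,\bar{\chi}_3$ such that $\langle\chi_1,\chi_2,\chi_3\rangle\neq\emptyset$, then the triple Massey product $\langle\chi_1,\chi_2,\chi_3\rangle$ does not contain $0$. Such extensions $\chi_1,\chi_2,\chi_3$ exist in particular if $G=G(3,\ell)$.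
   Context: In the profinite case, $\mathrm{Hom}$, $\mathrm{Aut}$, maps and group cohomology are continuous, ''generated'' means topologically generated (smallest closed subgroup), and $\mathbb{Z}/\ell$ and finite groups are discrete. $[x,y]=xyx^{-1}y^{-1}$. Lower central $\ell$-series: $\Omega_{1,\ell}=\Omega$ and $\Omega_{i+1,\ell}$ is the subgroup generated by $[\Omega_{i,\ell},\Omega]$ and all $\ell$-th powers of elements of $\Omega_{i,\ell}$. $G(i,\ell)$ is the kernel of the homomorphism $G\to\mathrm{Aut}(\Omega/\Omega_{i,\ell})$ induced by $\varphi$. Write $\Phi.\omega=\varphi(\Phi)(\omega)$. The homomorphism $\tau_{3,\ell}:G(3,\ell)\to\mathrm{Hom}(\Omega,\Omega_{3,\ell}/\Omega_{4,\ell})$ is defined by $\tau_{3,\ell}(\Phi)(\omega)=(\Phi.\omega)\,\omega^{-1}\bmod\Omega_{4,\ell}$. Let $U_4(\mathbb{Z}/\ell)$ be the group of upper triangular unipotent $4\times4$ matrices over $\mathbb{Z}/\ell$ and $Z(U_4(\mathbb{Z}/\ell))$ its center (the matrices whose only possibly non-zero off-diagonal entry is at position $(1,4)$). For a group $\Gamma$ (abstract or profinite) acting trivially on $\mathbb{Z}/\ell$ and $\chi_1,\chi_2,\chi_3\in\mathrm{Hom}(\Gamma,\mathbb{Z}/\ell)$, a defining system for $\langle\chi_1,\chi_2,\chi_3\rangle$ is a pair of maps $\kappa_{1,2},\kappa_{2,3}:\Gamma\to\mathbb{Z}/\ell$ such that $$\sigma\mapsto\begin{pmatrix}1&\chi_1(\sigma)&\kappa_{1,2}(\sigma)&*\\0&1&\chi_2(\sigma)&\kappa_{2,3}(\sigma)\\0&0&1&\chi_3(\sigma)\\0&0&0&1\end{pmatrix}$$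 is a homomorphism $\Gamma\to U_4(\mathbb{Z}/\ell)/Z(U_4(\mathbb{Z}/\ell))$. The triple Massey product $\langle\chi_1,\chi_2,\chi_3\rangle\subseteq\mathrm{H}^2(\Gamma,\mathbb{Z}/\ell)$ is the set of classes of all 2-cocycles $\nu$ for which there is a defining system with $\nu(\sigma,\tau)=-\chi_1(\sigma)\kappa_{2,3}(\tau)-\kappa_{1,2}(\sigma)\chi_3(\tau)$ for all $\sigma,\tau\in\Gamma$; it is empty if no defining system exists. It contains $0$ if and only if there is a homomorphism $\rho:\Gamma\to U_4(\mathbb{Z}/\ell)$ whose entries just above the diagonal are $\chi_1,\chi_2,\chi_3$. The map $h_\ell$: when $\langle\bar\chi_1,\bar\chi_2,\bar\chi_3\rangle$ contains $0$ (condition (i)), choose a homomorphism $\rho_\Omega:\Omega\to U_4(\mathbb{Z}/\ell)$ whose entries just above the diagonal are $\bar\chi_1,\bar\chi_2,\bar\chi_3$. Then $\rho_\Omega(\Omega_{3,\ell})\subseteq Z(U_4(\mathbb{Z}/\ell))$, and $h_\ell:\Omega_{3,\ell}\to\mathbb{Z}/\ell$ is the homomorphism sending $\omega$ to the $(1,4)$ entry of $\rho_\Omega(\omega)$. It depends only on $\bar\chi_1,\bar\chi_2,\bar\chi_3$, not on $\rho_\Omega$, and factors through $\Omega_{3,\ell}/\Omega_{4,\ell}$; the same symbol denotes the induced map on $\Omega_{3,\ell}/\Omega_{4,\ell}$. *)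

(* Defs.v *)
From HB Require Import structures.
From mathcomp Require Import all_boot all_order all_algebra all_fingroup.
From mathcomp Require Import center ring_quotient all_classical.
From mathcomp Require Import ring.
From mathcomp Require Import topology function_spaces separation_axioms.

Set Implicit Arguments.
Unset Strict Implicit.
Unset Printing Implicit Defensive.
Import GRing.Theory.
Import Quotient.

Local Open Scope classical_set_scope.
Local Open Scope group_scope.

#[short(type="groupTopologicalType")]
HB.structure Definition GroupTopological := {T of monoid.Group T & Topological T}.

Definition topological_group (T : groupTopologicalType) : Prop :=
  continuous (fun p : T * T => p.1 * p.2) /\ continuous (fun x : T => x^-1).

Definition profinite (T : groupTopologicalType) : Prop :=
  [/\ topological_group T, compact [set: T], hausdorff_space T
    & totally_disconnected [set: T]].

(* An abstract group is a group with the discrete topology: every map out of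
   it is continuous and every subgroup of it is closed, so that the continuous
   notions below are then the abstract ones. *)
Definition abstract_group (T : groupTopologicalType) : Prop :=
  forall A : set T, open A.

Definition discrete_group (T : groupType) : Type := discrete_topology T.
HB.instance Definition _ (T : groupType) := monoid.Group.copy (discrete_group T) T.
HB.instance Definition _ (T : groupType) :=
  Topological.copy (discrete_group T) (discrete_topology T).

Record cont_hom (A B : groupTopologicalType) := ContHom {
  hom_fun :> A -> B;
  hom_cont : continuous hom_fun;
  homM : {morph hom_fun : x y / x * y >-> x * y} }.

Definition is_aut (T : groupTopologicalType) (f : T -> T) : Prop :=
  exists g : T -> T, [/\ cancel f g, cancel g f,
    {morph f : x y / x * y >-> x * y}, continuous f & continuous g].

Section Aut.
Variable T : groupTopologicalType.

Record cont_aut := ContAut { aut_fun :> T -> T; autP : `[< is_aut aut_fun >] }.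

HB.instance Definition _ := [isSub for aut_fun].
HB.instance Definition _ := [Choice of cont_aut by <:].

Lemma aut_ext (a b : cont_aut) : (forall x, a x = b x) -> a = b.
Proof. by move=> ab; apply: val_inj; apply/funext. Qed.

Lemma aut1_subproof : `[< is_aut (@id T) >].
Proof. by apply/asboolP; exists id; split => // x; exact: cvg_id. Qed.
Definition aut1 := ContAut aut1_subproof.

Lemma autM_subproof (a b : cont_aut) : `[< is_aut (a \o b) >].
Proof.
have /asboolP[a' [aK a'K aM ac a'c]] := autP a.
have /asboolP[b' [bK b'K bM bc b'c]] := autP b.
apply/asboolP; exists (b' \o a'); split.
- by move=> x /=; rewrite aK bK.
- by move=> x /=; rewrite b'K a'K.
- by move=> x y /=; rewrite bM aM.
- by move=> x; apply: continuous_comp; [exact: bc|exact: ac].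
- by move=> x; apply: continuous_comp; [exact: a'c|exact: b'c].
Qed.
Definition autM (a b : cont_aut) := ContAut (autM_subproof a b).

Lemma autV_subproof (a : cont_aut) :
  {b : cont_aut | cancel a b /\ cancel b a}.
Proof.
apply: cid; have /asboolP[a' [aK a'K aM ac a'c]] := autP a.
suff a'P : `[< is_aut a' >] by exists (ContAut a'P).
apply/asboolP; exists a; split => // x y.
by apply: (can_inj aK); rewrite aM !a'K.
Qed.
Definition autV (a : cont_aut) : cont_aut := sval (autV_subproof a).

Lemma autMA : associative autM.
Proof. by move=> a b c; exact: aut_ext. Qed.
Lemma aut1M : left_id aut1 autM.
Proof. by move=> a; exact: aut_ext. Qed.
Lemma autM1 : right_id aut1 autM.
Proof. by move=> a; exact: aut_ext. Qed.
Lemma autVM : left_inverse aut1 autV autM.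
Proof.
by move=> a; apply: aut_ext => x; rewrite /= /autV; case: autV_subproof => b [].
Qed.
Lemma autMV : right_inverse aut1 autV autM.
Proof.
by move=> a; apply: aut_ext => x; rewrite /= /autV; case: autV_subproof => b [].
Qed.

HB.instance Definition _ := isGroup.Build cont_aut autMA aut1M autM1 autVM autMV.
HB.instance Definition _ := Topological.copy cont_aut
  (initial_topology (aut_fun : cont_aut -> {compact-open, T -> T})).

End Aut.

Definition semidirect (Omega G : groupTopologicalType) (phi : cont_hom G (cont_aut Omega)) :
  Type := (Omega * G)%type.

Section Semidirect.
Variables (Omega G : groupTopologicalType) (phi : cont_hom G (cont_aut Omega)).
Local Notation semidirect := (semidirect phi).

HB.instance Definition _ := Topological.copy semidirect (Omega * G)%type.

Definition semi1 : semidirect := (1, 1).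
Definition semiM (a b : semidirect) : semidirect :=
  (a.1 * phi a.2 b.1, a.2 * b.2).
Definition semiV (a : semidirect) : semidirect :=
  ((phi a.2)^-1 (a.1^-1), a.2^-1).

Lemma aut_morphM (a : cont_aut Omega) : {morph a : x y / x * y >-> x * y}.
Proof. by have /asboolP[b []] := autP a. Qed.
Lemma aut_morph1 (a : cont_aut Omega) : a 1 = 1.
Proof. by apply: (mulgI (a 1)); rewrite -aut_morphM !mulg1. Qed.
Lemma aut_mulE (a b : cont_aut Omega) x : (a * b) x = a (b x).
Proof. by []. Qed.
Lemma hom_morph1 : phi 1 = 1.
Proof. by apply: (mulgI (phi 1)); rewrite -homM !mulg1. Qed.
Lemma hom_morphV g : phi g^-1 = (phi g)^-1.
Proof. by apply: (mulgI (phi g)); rewrite -homM !mulgV hom_morph1. Qed.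

Lemma semiMA : associative semiM.
Proof.
by move=> a b c; rewrite /semiM /= homM !aut_mulE aut_morphM !mulgA.
Qed.
Lemma semi1M : left_id semi1 semiM.
Proof. by case=> o g; rewrite /semiM /= hom_morph1 !mul1g. Qed.
Lemma semiM1 : right_id semi1 semiM.
Proof. by case=> o g; rewrite /semiM /= aut_morph1 !mulg1. Qed.
Lemma semiVM : left_inverse semi1 semiV semiM.
Proof.
case=> o g; rewrite /semiM /semiV /= hom_morphV mulVg -aut_morphM mulVg.
by rewrite aut_morph1.
Qed.
Lemma semiMV : right_inverse semi1 semiV semiM.
Proof.
by case=> o g; rewrite /semiM /semiV /= -aut_mulE !mulgV.
Qed.

HB.instance Definition _ :=
  isGroup.Build semidirect semiMA semi1M semiM1 semiVM semiMV.

End Semidirect.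

Section CentralSeries.
Variables (l : nat) (Omega : groupTopologicalType).

Definition closed_subgroup (H : set Omega) : Prop :=
  [/\ closed H, H 1, forall x y, H x -> H y -> H (x * y)
    & forall x, H x -> H x^-1].

(* [x, y] = x y x^-1 y^-1, as opposed to the library's [~ x, y]. *)
Definition group_comm (x y : Omega) : Omega := x * y * x^-1 * y^-1.

Definition lcs_next (H : set Omega) : set Omega :=
  smallest closed_subgroup
    ([set z | exists x y, H x /\ z = group_comm x y] `|`
     [set z | exists2 x, H x & z = x ^+ l]).

(* The series is indexed from 1; index 0 is not used. *)
Definition lcs (i : nat) : set Omega := iter i.-1 lcs_next setT.

Definition coset_mod (N : set Omega) (x : Omega) : set Omega :=
  [set x * n | n in N].

End CentralSeries.

Section Tau.
Variables (l : nat) (Omega G : groupTopologicalType) (phi : cont_hom G (cont_aut Omega)).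

Definition lcs_kernel (i : nat) : set G :=
  [set g | forall x : Omega,
    coset_mod (lcs l i) (phi g x) = coset_mod (lcs l i) x].

Definition tau3 (g : G) (x : Omega) : set Omega :=
  coset_mod (lcs l 4) (phi g x * x^-1).

End Tau.

Section U4.
Variable l : nat.
Implicit Types M : 'M['F_l]_4.

Definition unitriangular M : bool :=
  is_trig_mx M^T && [forall i, M i i == 1%R].

Lemma unitriangular_det M : unitriangular M -> (\det M = 1)%R.
Proof.
case/andP=> Mt /forallP M1; rewrite -det_tr det_trig// big1// => i _.
by rewrite mxE; apply/eqP.
Qed.

Lemma unitriangular_unit M : unitriangular M -> M \is a GRing.unit.
Proof. by move=> /unitriangular_det Md; rewrite unitmxE Md unitr1. Qed.

Definition U4 : {set {'GL_4['F_l]}} :=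
  [set g : {'GL_4['F_l]} | unitriangular (GLval g)]%SET.

Lemma unitriangularM M N :
  unitriangular M -> unitriangular N -> unitriangular (M *m N)%R.
Proof.
have tP (P : 'M['F_l]_4) :
    is_trig_mx P^T -> forall i j : 'I_4, j < i -> P i j = 0%R.
  by move/is_trig_mxP => Pt i j ji; have := Pt j i ji; rewrite mxE.
move=> /andP[/tP Mt /forallP M1] /andP[/tP Nt /forallP N1].
apply/andP; split.
  apply/is_trig_mxP => i j ij; rewrite !mxE big1// => k _.
  by case: (ltnP k j) => kj; [rewrite Mt ?mul0r|rewrite Nt ?mulr0// (leq_trans ij)].
apply/forallP => i; rewrite mxE (bigD1 i)//= big1 ?addr0.
  by rewrite (eqP (M1 i)) (eqP (N1 i)) mulr1.
move=> k ki; case: (ltngtP k i) => [k_i|i_k|/val_inj kE].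
- by rewrite Mt ?mul0r.
- by rewrite Nt ?mulr0.
- by rewrite kE eqxx in ki.
Qed.

Lemma U4_group_set : group_set U4.
Proof.
apply/group_setP; split => [|x y]; rewrite !inE.
  apply/andP; split; last by apply/forallP => i; rewrite mxE eqxx.
  apply/is_trig_mxP => i j ij; rewrite !mxE.
  by case: eqP => // ji; rewrite ji ltnn in ij.
exact: unitriangularM.
Qed.
Canonical U4_group := Group U4_group_set.

Definition U4_entries (a b c d e f : 'F_l) : seq (seq 'F_l) :=
  [:: [:: 1; a; d; f];
      [:: 0; 1; b; e];
      [:: 0; 0; 1; c];
      [:: 0; 0; 0; 1]]%R.

Definition U4_mx (a b c d e f : 'F_l) : 'M['F_l]_4 :=
  (\matrix_(i, j) (nth [::] (U4_entries a b c d e f) i)`_j)%R.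

Lemma U4_mx_unitriangular a b c d e f : unitriangular (U4_mx a b c d e f).
Proof.
apply/andP; split.
  by apply/is_trig_mxP => -[[|[|[|[|i]]]] hi] [[|[|[|[|j]]]] hj]//=; rewrite !mxE.
by apply/forallP => -[[|[|[|[|i]]]] hi]; rewrite mxE//=.
Qed.

Definition U4_elt (a b c d e f : 'F_l) : {'GL_4['F_l]} :=
  FinRing.unit _ (unitriangular_unit (U4_mx_unitriangular a b c d e f)).

Definition entry (g : {'GL_4['F_l]}) (i j : nat) : 'F_l :=
  GLval g (inord i) (inord j).

End U4.

Definition cont_Fl (l : nat) (X : topologicalType) (f : X -> 'F_l) : Prop :=
  continuous (f : X -> discrete_topology 'F_l).

Record character (l : nat) (T : groupTopologicalType) := Character {
  character_fun :> T -> 'F_l;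
  character_cont : cont_Fl character_fun;
  characterM : {morph character_fun : x y / x * y >-> (x + y)%R} }.

Section Cohomology.
Variables (l : nat) (T : groupTopologicalType).
Local Open Scope ring_scope.

Lemma cont_FlP (X : topologicalType) (f : X -> 'F_l) :
  cont_Fl f <-> forall x, \forall y \near x, f y = f x.
Proof.
split=> [fc x|fc x A /= Ax].
  exact: (fc x [set f x]).
apply: filterS (fc x) => y fyE; rewrite /= fyE.
exact: nbhs_singleton Ax.
Qed.

Lemma cont_FlB (X : topologicalType) (f g : X -> 'F_l) :
  cont_Fl f -> cont_Fl g -> cont_Fl (f - g).
Proof.
move=> /cont_FlP fc /cont_FlP gc; apply/cont_FlP => x; near=> y.
rewrite !fctE; congr (_ - _); first by near: y; exact: fc.
by near: y; exact: gc.
Unshelve. all: by end_near. Qed.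

Lemma cont_Fl0 (X : topologicalType) : cont_Fl (0 : X -> 'F_l).
Proof. by apply/cont_FlP => x; near=> y. Unshelve. all: by end_near. Qed.

Definition is_cocycle2 (nu : T * T -> 'F_l) : Prop :=
  cont_Fl nu /\ forall s t u : T,
    nu (t, u) - nu ((s * t)%g, u) + nu (s, (t * u)%g) - nu (s, t) = 0.

Definition cocycle2_pred : {pred T * T -> 'F_l} :=
  fun nu => `[< is_cocycle2 nu >].

Lemma cocycle2_zmod_closed : zmod_closed cocycle2_pred.
Proof.
split=> [|f g /asboolP[fc fZ] /asboolP[gc gZ]]; apply/asboolP; split.
- exact: cont_Fl0.
- by move=> s t u; rewrite !subr0 addr0.
- exact: cont_FlB.
move=> s t u; rewrite !fctE -[RHS](subrr 0) -{1}(fZ s t u) -(gZ s t u).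
by rewrite !opprD !opprK; ring.
Qed.
HB.instance Definition _ :=
  GRing.isZmodClosed.Build _ cocycle2_pred cocycle2_zmod_closed.

Record cocycle2 := Cocycle2 {
  cocycle2_fun :> T * T -> 'F_l;
  cocycle2P : cocycle2_fun \in cocycle2_pred }.
HB.instance Definition _ := [isSub for cocycle2_fun].
HB.instance Definition _ := [Choice of cocycle2 by <:].
HB.instance Definition _ := [SubChoice_isSubZmodule of cocycle2 by <:].

Definition is_coboundary2 (nu : T * T -> 'F_l) : Prop :=
  exists2 c : T -> 'F_l, cont_Fl c &
    forall s t : T, nu (s, t) = c t - c (s * t)%g + c s.

Definition coboundary2_pred : {pred cocycle2} :=
  fun nu => `[< is_coboundary2 nu >].

Lemma coboundary2_zmod_closed : zmod_closed coboundary2_pred.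
Proof.
split=> [|f g /asboolP[c cc fE] /asboolP[d dc gE]]; apply/asboolP.
  by exists 0; [exact: cont_Fl0|move=> s t; rewrite -[LHS]/(0 : _) subr0 addr0].
exists (c - d) => [|s t]; first exact: cont_FlB.
by rewrite -[LHS]/(f (s, t) - g (s, t)) fE gE !fctE; ring.
Qed.
HB.instance Definition _ :=
  GRing.isZmodClosed.Build _ coboundary2_pred coboundary2_zmod_closed.

Definition H2 := {quot coboundary2_pred}.

End Cohomology.

Section Massey.
Variables (l : nat) (T : groupTopologicalType) (chi1 chi2 chi3 : character l T).

(* The entry in position (1, 4) does not matter modulo the center; it is 0. *)
Definition defining_map (k12 k23 : T -> 'F_l) (s : T) : coset_of 'Z(U4 l) :=
  coset 'Z(U4 l) (U4_elt (chi1 s) (chi2 s) (chi3 s) (k12 s) (k23 s) 0%R).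

Definition defining_system (k12 k23 : T -> 'F_l) : Prop :=
  [/\ cont_Fl k12, cont_Fl k23,
      continuous (defining_map k12 k23 : T -> discrete_group (coset_of 'Z(U4 l)))
    & {morph defining_map k12 k23 : s t / s * t}].

Definition massey : set (H2 l T) :=
  [set x | exists nu : cocycle2 l T, x = \pi_(H2 l T)%qT nu /\
    exists k12 k23, defining_system k12 k23 /\
      forall s t, nu (s, t) = (- (chi1 s * k23 t) - k12 s * chi3 t)%R].

Definition U4_lift : set (T -> {'GL_4['F_l]}) :=
  [set r | [/\ continuous (r : T -> discrete_group {'GL_4['F_l]}),
      {morph r : s t / s * t}, forall s, r s \in U4 l
    & forall s, [/\ entry (r s) 0 1 = chi1 s, entry (r s) 1 2 = chi2 s
        & entry (r s) 2 3 = chi3 s]]].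

(* [xget] chooses a lift; it returns the junk value 1 only if there is none,
   that is, only if [massey] does not contain 0. *)
Definition massey_rho : T -> {'GL_4['F_l]} := xget (fun=> 1) U4_lift.

Definition h_l (x : T) : 'F_l := entry (massey_rho x) 0 3.

(* The map induced by [h_l] on cosets modulo the fourth term of the series,
   evaluated at a chosen element of the coset. *)
Definition h_l_coset (C : set T) : 'F_l := h_l (xget 1 C).

End Massey.

Definition lin_indep2 (l : nat) (T : groupTopologicalType)
    (chi psi : character l T) : Prop :=
  forall a b : 'F_l, (forall x, a * chi x + b * psi x = 0)%R -> a = 0%R /\ b = 0%R.

Definition extends (l : nat) (Omega G : groupTopologicalType) 
    (phi : cont_hom G (cont_aut Omega))
    (chi : character l (semidirect phi)) (chibar : character l Omega) : Prop :=
  forall x : Omega, chi ((x, 1) : semidirect phi) = chibar x.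

(* Main.v *)
Require Import Defs.
From HB Require Import structures.
From mathcomp Require Import all_boot all_order all_algebra all_fingroup.
From mathcomp Require Import center ring_quotient all_classical ring.
From mathcomp Require Import topology function_spaces separation_axioms.

Import GRing.Theory.

Local Open Scope classical_set_scope.
Local Open Scope group_scope.

(** A homomorphism to the unitriangular matrices of
size four is a triple of characters [c1, c2, c3] with three further functions
[k12, k23, k13], the entries above them, subject to the multiplication rule of
matrices; a defining system is the same thing without the corner [k13]. The
vanishing of a Massey product says that the corner can be filled in, because
filling it in is the same as trivialising the cocycle
[- c1 k23 - k12 c3] ([massey0_lift]).

Since [3 < l], unitriangular matrices have exponent [l]. So a lift maps the
second, third and fourth terms of the lower central [l]-series into the
commutator subgroup, the centre and the trivial group. On commutators, each entry is a
polynomial in the entries closer to the diagonal. Applying this twice shows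
that two lifts of the same characters agree on the third term ([lcs3_sub]), so
that the chosen lift behind [h_l] can be exchanged for any other.

Suppose that the Massey product of the extended characters contains [0], and
let [rho] be a lift of them to the semidirect product. For [g] in [G(3, l)] and
[x] in [Omega], the commutator of [g] and [x] is [(g.x) x^-1], a conjugate of an
element of the third term, hence [rho] sends it to the centre. The vanishing of
its (1, 3) and (2, 4) entries reads
  [chi1 g * c2 x = c1 x * chi2 g] and [chi2 g * c3 x = c2 x * chi3 g]
for all [x], and linear independence forces [chi1 g = chi2 g = chi3 g = 0]
([minors_eq0]). But then [rho g] and [rho x0] both lie in the abelian group of
matrices with zero superdiagonal when the characters vanish at [x0], so their
commutator is trivial. Its corner is [h_l] of [tau3 g x0], which therefore
vanishes ([tau3_obstruction]).

If [G = G(3, l)], then [G] moves elements of [Omega] only by elements that a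
lift sends to the centre. Hence the characters and the defining system that
come from a lift on [Omega] are [G]-invariant, and composing them with the
projection [(x, g) |-> x] extends them ([inflated_massey_nonempty]). *)

(** * Coordinates on the group of unitriangular matrices *)

Section Coordinates.
Context {l : nat}.
Implicit Types (a b c d e f : 'F_l) (g : {'GL_4['F_l]}).

Lemma U4_eltM a b c d e f a' b' c' d' e' f' :
  U4_elt a b c d e f * U4_elt a' b' c' d' e' f' =
  U4_elt (a + a')%R (b + b')%R (c + c')%R (d + d' + a * b')%R
    (e + e' + b * c')%R (f + f' + (a * e' + d * c'))%R.
Proof.
apply: val_inj; apply/matrixP => i j.
rewrite /= !mxE !big_ord_recl big_ord0 /= !mxE /=.
by case: i j => [[|[|[|[|i]]]] hi] [[|[|[|[|j]]]] hj] //=; ring.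
Qed.

Lemma U4_elt_in a b c d e f : U4_elt a b c d e f \in U4 l.
Proof. by rewrite inE; exact: U4_mx_unitriangular. Qed.

Lemma entry_U4_elt a b c d e f :
  let g := U4_elt a b c d e f in
  [/\ entry g 0 1 = a, entry g 1 2 = b & entry g 2 3 = c] /\
  [/\ entry g 0 2 = d, entry g 1 3 = e & entry g 0 3 = f].
Proof. by rewrite /entry /= !mxE !inordK. Qed.

Lemma U4_elt_entries g : g \in U4 l ->
  g = U4_elt (entry g 0 1) (entry g 1 2) (entry g 2 3)
             (entry g 0 2) (entry g 1 3) (entry g 0 3).
Proof.
rewrite inE => /andP[/is_trig_mxP gt /forallP g1].
apply: val_inj; apply/matrixP => i j; rewrite /= mxE.
have ltE (p q : 'I_4) : (p < q)%N -> GLval g q p = 0%R.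
  by move=> pq; have := gt p q pq; rewrite mxE.
case: i j => [[|[|[|[|i]]]] hi] [[|[|[|[|j]]]] hj] //=.
all: try by rewrite ltE.
all: try by (rewrite -(eqP (g1 (Ordinal hi))); congr (GLval g _ _);
             exact: val_inj).
all: by rewrite /entry; congr (GLval g _ _); apply: val_inj; rewrite /= inordK.
Qed.

Lemma U4_elt_inj a b c d e f a' b' c' d' e' f' :
  U4_elt a b c d e f = U4_elt a' b' c' d' e' f' ->
  [/\ a = a', b = b' & c = c'] /\ [/\ d = d', e = e' & f = f'].
Proof.
move=> E; have := entry_U4_elt a b c d e f; rewrite E /=.
have [[-> -> ->] [-> -> ->]] := entry_U4_elt a' b' c' d' e' f'.
by move=> [[-> -> ->] [-> -> ->]].
Qed.

Lemma U4_elt_center f : U4_elt 0%R 0%R 0%R 0%R 0%R f \in 'Z(U4 l).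
Proof.
apply/centerP; split=> [|y /U4_elt_entries ->]; first exact: U4_elt_in.
by rewrite /commute !U4_eltM; congr U4_elt; ring.
Qed.

(** Commuting with the elementary matrices next to the diagonal already kills
every entry except the corner. *)
Lemma center_U4 g : g \in 'Z(U4 l) ->
  exists f, g = U4_elt 0%R 0%R 0%R 0%R 0%R f.
Proof.
move=> /centerP[/U4_elt_entries ->].
move: (entry g 0 1) (entry g 1 2) (entry g 2 3) (entry g 0 2) (entry g 1 3)
  (entry g 0 3) => a b c d e f gC.
have comm (a' b' c' : 'F_l) : [/\ (a * b' = a' * b)%R,
    (b * c' = b' * c)%R & (d * c' = a' * e)%R].
  move: (gC _ (U4_elt_in a' b' c' 0%R 0%R 0%R)); rewrite /commute !U4_eltM.
  move=> /U4_elt_inj[_ [dE eE fE]]; split.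
  - by move: dE; rewrite addr0 add0r => /addrI.
  - by move: eE; rewrite addr0 add0r => /addrI.
  - by move: fE; rewrite mulr0 mul0r !addr0 !add0r => /addrI.
have [_ c0 _] := comm 0%R 1%R 0%R; have [b0 _ e0] := comm 1%R 0%R 0%R.
have [a0 _ _] := comm 0%R 1%R 0%R; have [_ _ d0] := comm 0%R 0%R 1%R.
exists f; congr U4_elt.
- by rewrite -[a]mulr1 a0 mul0r.
- by rewrite -[b]mul1r -b0 mulr0.
- by rewrite -[c]mul1r -c0 mulr0.
- by rewrite -[d]mulr1 d0 mul0r.
- by rewrite -[e]mul1r -e0 mulr0.
Qed.

Lemma U4_elt_norm a b c d e f : U4_elt a b c d e f \in 'N('Z(U4 l)).
Proof.
apply: (fintype.subsetP (char_norm (center_char [group of U4 l]))).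
exact: U4_elt_in.
Qed.

(** The centre consists of the matrices supported in the corner, so a class
modulo the centre is the list of the other five entries. *)
Lemma coset_U4_eltP a b c d e f a' b' c' d' e' f' :
  coset 'Z(U4 l) (U4_elt a b c d e f) =
    coset 'Z(U4 l) (U4_elt a' b' c' d' e' f')
  <-> [/\ a = a', b = b' & c = c'] /\ d = d' /\ e = e'.
Proof.
split=> [/rcoset_kercosetP|[[-> -> ->] [-> ->]]].
  move=> /(_ (U4_elt_norm _ _ _ _ _ _) (U4_elt_norm _ _ _ _ _ _)).
  case/rcosetP => z /center_U4[h ->]; rewrite U4_eltM.
  by move=> /U4_elt_inj[[-> -> ->] [-> -> _]]; rewrite !mul0r !add0r !addr0.
apply/rcoset_kercosetP; try exact: U4_elt_norm.
apply/rcosetP; exists (U4_elt 0 0 0 0 0 (f - f'))%R; first exact: U4_elt_center.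
by rewrite U4_eltM; congr U4_elt; ring.
Qed.

End Coordinates.

(** * Unipotent representations in coordinates *)

(** The coboundary of [- k] is the cup product of [a] and [b]. *)
Definition cup_primitive {l : nat} {T : groupTopologicalType}
    (a b k : T -> 'F_l) : Prop :=
  forall x y, k (x * y) = (k x + k y + a x * b y)%R.

(** The conditions under which [k12, k23] complete the characters [a1, a2, a3] on
the superdiagonal to a homomorphism to unitriangular matrices modulo centre. *)
Record central_quotient_lift {l : nat} {T : groupTopologicalType}
    (a1 a2 a3 k12 k23 : T -> 'F_l) : Prop := CentralQuotientLift {
  k12_cont : cont_Fl k12;
  k23_cont : cont_Fl k23;
  k12M : cup_primitive a1 a2 k12;
  k23M : cup_primitive a2 a3 k23 }.

(** The conditions under which the entries [k12, k23, k13] complete the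
superdiagonal to a homomorphism to unitriangular matrices. *)
Record unipotent_lift {l : nat} {T : groupTopologicalType}
    (a1 a2 a3 k12 k23 k13 : T -> 'F_l) : Prop := UnipotentLift {
  lift_quotient : central_quotient_lift a1 a2 a3 k12 k23;
  k13_cont : cont_Fl k13;
  k13M : forall x y,
    k13 (x * y) = (k13 x + k13 y + (a1 x * k23 y + k12 x * a3 y))%R }.

Arguments k12M {l T a1 a2 a3 k12 k23}.
Arguments k23M {l T a1 a2 a3 k12 k23}.
Arguments lift_quotient {l T a1 a2 a3 k12 k23 k13}.
Arguments k13M {l T a1 a2 a3 k12 k23 k13}.

Section Representations.
Context {l : nat} {T : groupTopologicalType}.
Context {c1 c2 c3 : character l T}.

Lemma locally_constant_continuous (X : groupType) (f : T -> discrete_group X) :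
  (forall x, \forall y \near x, f y = f x) -> continuous f.
Proof.
move=> fc x A /= Ax; apply: filterS (fc x) => y fyE; rewrite /= fyE.
exact: nbhs_singleton Ax.
Qed.

Lemma character_near (c : character l T) x : \forall y \near x, c y = c x.
Proof. by move: x; apply/cont_FlP; exact: character_cont. Qed.

Lemma defining_systemP (k12 k23 : T -> 'F_l) :
  defining_system c1 c2 c3 k12 k23 <->
  central_quotient_lift c1 c2 c3 k12 k23.
Proof.
have nZ x : U4_elt (c1 x) (c2 x) (c3 x) (k12 x) (k23 x) 0%R \in 'N('Z(U4 l)).
  exact: U4_elt_norm.
have coordM x y : defining_map c1 c2 c3 k12 k23 (x * y) =
    defining_map c1 c2 c3 k12 k23 x * defining_map c1 c2 c3 k12 k23 y <->
    k12 (x * y) = (k12 x + k12 y + c1 x * c2 y)%R /\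
    k23 (x * y) = (k23 x + k23 y + c2 x * c3 y)%R.
  rewrite /defining_map -coset_morphM ?nZ// U4_eltM coset_U4_eltP !characterM.
  by split=> [[]|].
split=> [[k12c k23c _ kM]|[k12c k23c k12M k23M]].
  by split=> // x y; have [] := (coordM x y).1 (kM x y).
split=> //; last by move=> x y; apply/coordM; split.
apply: locally_constant_continuous => x; near=> y.
rewrite /defining_map; congr (coset _ (U4_elt _ _ _ _ _ _)).
- by near: y; exact: character_near.
- by near: y; exact: character_near.
- by near: y; exact: character_near.
- by near: y; move/cont_FlP: k12c; exact.
- by near: y; move/cont_FlP: k23c; exact.
Unshelve. all: by end_near. Qed.

Lemma U4_lift_coords (r : T -> {'GL_4['F_l]}) :
  U4_lift c1 c2 c3 r ->
  unipotent_lift c1 c2 c3 (fun x => entry (r x) 0 2) (fun x => entry (r x) 1 3)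
    (fun x => entry (r x) 0 3).
Proof.
case=> rc rM rU rchi.
have entry_cont i j : cont_Fl (fun x => entry (r x) i j).
  apply/cont_FlP => x.
  have rx : \forall y \near x, r y = r x by exact: (rc x [set r x]).
  by apply: filterS rx => y ->.
have rE x : r x = U4_elt (c1 x) (c2 x) (c3 x)
    (entry (r x) 0 2) (entry (r x) 1 3) (entry (r x) 0 3).
  by rewrite {1}[r x]U4_elt_entries//; case: (rchi x) => -> -> ->.
have mE x y : U4_elt (c1 (x * y)) (c2 (x * y)) (c3 (x * y))
    (entry (r (x * y)) 0 2) (entry (r (x * y)) 1 3) (entry (r (x * y)) 0 3) =
    U4_elt (c1 x) (c2 x) (c3 x)
      (entry (r x) 0 2) (entry (r x) 1 3) (entry (r x) 0 3) *
    U4_elt (c1 y) (c2 y) (c3 y)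
      (entry (r y) 0 2) (entry (r y) 1 3) (entry (r y) 0 3).
  by rewrite -!rE rM.
do 2 ?split=> //.
- by move=> x y; have := mE x y; rewrite U4_eltM => /U4_elt_inj[_ []].
- by move=> x y; have := mE x y; rewrite U4_eltM => /U4_elt_inj[_ []].
- by move=> x y; have := mE x y; rewrite U4_eltM => /U4_elt_inj[_ []].
Qed.

(** A cochain whose coboundary is the Massey cocycle of a defining system is
exactly what is missing in the (1, 4) entry. *)
Lemma massey0_lift :
  massey c1 c2 c3 0%R -> exists r, U4_lift c1 c2 c3 r.
Proof.
case=> nu [nu0 [k12 [k23 [/defining_systemP[k12c k23c k12M k23M] nuE]]]].
have /asboolP[k kc kE] : nu \in coboundary2_pred (l := l) (T := T).
  by rewrite -[nu]subr0 Quotient.idealrBE -nu0 raddf0.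
exists (fun x => U4_elt (c1 x) (c2 x) (c3 x) (k12 x) (k23 x) (k x)); split.
- apply: locally_constant_continuous => x; near=> y; congr U4_elt.
  + by near: y; exact: character_near.
  + by near: y; exact: character_near.
  + by near: y; exact: character_near.
  + by near: y; move/cont_FlP: k12c; exact.
  + by near: y; move/cont_FlP: k23c; exact.
  + by near: y; move/cont_FlP: kc; exact.
- move=> x y; rewrite U4_eltM !characterM k12M k23M; congr U4_elt.
  transitivity (k x + k y - (k y - k (x * y)%g + k x))%R; first by ring.
  by rewrite -kE nuE; ring.
- by move=> x; exact: U4_elt_in.
- move=> x.
  by have [] := entry_U4_elt (c1 x) (c2 x) (c3 x) (k12 x) (k23 x) (k x).
Unshelve. all: by end_near. Qed.

(** The content is that the Massey cochain of a defining system is closed and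
continuous, so that it has a class. *)
Lemma massey_nonempty (k12 k23 : T -> 'F_l) :
  central_quotient_lift c1 c2 c3 k12 k23 -> massey c1 c2 c3 !=set0.
Proof.
move=> kP; have [k12c k23c k12M k23M] := kP.
pose nu (st : T * T) := (- (c1 st.1 * k23 st.2) - k12 st.1 * c3 st.2)%R.
have nuZ : nu \in cocycle2_pred (l := l) (T := T).
  apply/asboolP; split=> [|s t u]; last first.
    by rewrite /nu /= k12M k23M !characterM; ring.
  apply/cont_FlP => -[s t].
  have near1 (f : T -> 'F_l) : cont_Fl f -> \forall y \near (s, t), f y.1 = f s.
    move=> /cont_FlP/(_ s) fs.
    exact: (@cvg_fst _ _ (nbhs s) (nbhs t) _ _ fs).
  have near2 (f : T -> 'F_l) : cont_Fl f -> \forall y \near (s, t), f y.2 = f t.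
    move=> /cont_FlP/(_ t) ft.
    exact: (@cvg_snd _ _ (nbhs s) (nbhs t) _ _ ft).
  have c1s := near1 _ (@character_cont l T c1).
  have c3t := near2 _ (@character_cont l T c3).
  have k12s := near1 _ k12c; have k23t := near2 _ k23c.
  near=> y; rewrite /nu; congr (- (_ * _) - _ * _)%R; near: y; assumption.
exists (\pi_(H2 l T)%qT (Cocycle2 nuZ)), (Cocycle2 nuZ); split=> //.
by exists k12, k23; split=> //; apply/defining_systemP.
Unshelve. all: by end_near. Qed.

End Representations.

(** * Vanishing on the lower central series *)

Section CentralSeries.
Context {l : nat} {T : groupTopologicalType} {c1 c2 c3 : character l T}.
Context (l_prime : prime l) (l_gt3 : (3 < l)%N).

Lemma lcs_next_sub (H K : set T) : closed_subgroup K ->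
  (forall x y, H x -> K (group_comm x y)) -> (forall x, H x -> K (x ^+ l)) ->
  lcs_next l H `<=` K.
Proof.
move=> Kgrp Kcomm Kpow; apply: smallest_sub => // z.
by case=> [[x [y [Hx ->]]]|[x Hx ->]]; [exact: Kcomm|exact: Kpow].
Qed.

Lemma binomial_Fl0 n : (0 < n < l)%N -> ('C(l, n)%:R = 0 :> 'F_l)%R.
Proof.
move=> nl; apply/eqP; rewrite -(dvdn_pcharf (pchar_Fp l_prime)).
exact: prime_dvd_bin.
Qed.

Lemma character1 (c : character l T) : c 1 = 0%R.
Proof. by apply: (addrI (c 1)); rewrite -characterM mulg1 addr0. Qed.

Lemma characterV (c : character l T) x : c x^-1 = (- c x)%R.
Proof. by apply: (addrI (c x)); rewrite -characterM mulgV character1 subrr. Qed.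

Lemma character_comm (c : character l T) x y : c (group_comm x y) = 0%R.
Proof. by rewrite /group_comm !characterM !characterV; ring. Qed.

Lemma characterX (c : character l T) x n : c (x ^+ n) = (n%:R * c x)%R.
Proof.
elim: n => [|n IHn]; first by rewrite expg0 character1 mul0r.
by rewrite expgS characterM IHn -natr1; ring.
Qed.

Lemma group_commK (x y : T) : group_comm x y * (y * x) = x * y.
Proof. by rewrite /group_comm !mulgA !mulgKV. Qed.

Section Primitive.
Context {a b : character l T} {k : T -> 'F_l}.
Context (kM : cup_primitive a b k).

Lemma cup_primitive1 : k 1 = 0%R.
Proof.
by apply: (addrI (k 1)); have := kM 1 1; rewrite mulg1 !character1 mul0r !addr0.
Qed.

Lemma cup_primitive_comm x y :
  k (group_comm x y) = (a x * b y - a y * b x)%R.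
Proof.
have := kM (group_comm x y) (y * x).
rewrite group_commK (kM x y) (kM y x) character_comm mul0r addr0 => E.
by apply: (addIr (k y + k x + a y * b x)%R); rewrite -E; ring.
Qed.

Lemma cup_primitiveX x n :
  k (x ^+ n) = (n%:R * k x + 'C(n, 2)%:R * (a x * b x))%R.
Proof.
elim: n => [|n IHn]; first by rewrite expg0 cup_primitive1 bin0n !mul0r addr0.
by rewrite expgS kM IHn characterX binS bin1 natrD -natr1; ring.
Qed.

End Primitive.

Section Lift.
Context {k12 k23 k13 : T -> 'F_l}.
Context (kP : unipotent_lift c1 c2 c3 k12 k23 k13).
Let M12 := k12M (lift_quotient kP).
Let M23 := k23M (lift_quotient kP).
Let M13 := k13M kP.

Lemma unipotent_lift1 : k13 1 = 0%R.
Proof.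
apply: (addrI (k13 1)); have := M13 1 1.
by rewrite mulg1 !character1 mul0r mulr0 !addr0.
Qed.

(** The formula comes from comparing the entries of
[group_comm x y * (y * x)] and [x * y]. It expresses the corner by the
other entries only; hence it takes the same value for two lifts that share them. *)
Lemma unipotent_lift_comm x y :
  k13 (group_comm x y) =
  (c1 x * k23 y + k12 x * c3 y - c1 y * k23 x - k12 y * c3 x
   - (c1 x * c2 y - c1 y * c2 x) * (c3 x + c3 y))%R.
Proof.
have := M13 (group_comm x y) (y * x).
rewrite group_commK (M13 x y) (M13 y x) character_comm (cup_primitive_comm M12).
rewrite mul0r add0r characterM => E.
apply: (addIr (k13 y + k13 x + (c1 y * k23 x + k12 y * c3 x) +
  (c1 x * c2 y - c1 y * c2 x) * (c3 y + c3 x))%R).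
by rewrite addrA -E; ring.
Qed.

Lemma unipotent_liftX x n :
  k13 (x ^+ n) = (n%:R * k13 x + 'C(n, 2)%:R * (c1 x * k23 x + k12 x * c3 x)
                  + 'C(n, 3)%:R * (c1 x * c2 x * c3 x))%R.
Proof.
elim: n => [|n IHn].
  by rewrite expg0 unipotent_lift1 !bin0n !mul0r !addr0.
rewrite expgS M13 IHn (cup_primitiveX M23) characterX !binS bin1 !natrD -natr1.
by ring.
Qed.

(** The entries of the [l]-th power are combinations of the binomial
coefficients [l] choose [n] with [n = 1, 2, 3], all divisible by [l] because
[3 < l]. *)
Lemma unipotent_lift_expl x :
  [/\ c1 (x ^+ l) = 0%R, c2 (x ^+ l) = 0%R & c3 (x ^+ l) = 0%R] /\
  [/\ k12 (x ^+ l) = 0%R, k23 (x ^+ l) = 0%R & k13 (x ^+ l) = 0%R].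
Proof.
have l0 : (l%:R = 0 :> 'F_l)%R.
  by have := binomial_Fl0 1; rewrite bin1; apply; exact: ltn_trans l_gt3.
have b2 : ('C(l, 2)%:R = 0 :> 'F_l)%R.
  by rewrite binomial_Fl0//; exact: ltn_trans l_gt3.
have b3 : ('C(l, 3)%:R = 0 :> 'F_l)%R by rewrite binomial_Fl0.
split; split; rewrite ?characterX ?(cup_primitiveX M12) ?(cup_primitiveX M23)
  ?unipotent_liftX ?l0 ?b2 ?b3; ring.
Qed.

End Lift.

Definition character_kernel : set T :=
  [set x | [/\ c1 x = 0%R, c2 x = 0%R & c3 x = 0%R]].

(** The entries of a lift are not homomorphisms, but become so where the
superdiagonal vanishes; this is enough to make their zero loci subgroups. *)
Definition additive_on_kernel (f : T -> 'F_l) : Prop := forall x y,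
  character_kernel x -> character_kernel y -> f (x * y) = (f x + f y)%R.

Definition common_kernel (f g h : T -> 'F_l) : set T :=
  character_kernel `&` [set x | [/\ f x = 0%R, g x = 0%R & h x = 0%R]].

(** The functions being locally constant, their zero loci are also closed; this
is what bounds the terms of the series, which are closed by definition. *)
Lemma closed_subgroup_common_kernel (f g h : T -> 'F_l) :
  [/\ cont_Fl f, cont_Fl g & cont_Fl h] ->
  [/\ additive_on_kernel f, additive_on_kernel g & additive_on_kernel h] ->
  closed_subgroup (common_kernel f g h).
Proof.
move=> [/cont_FlP fc /cont_FlP gc /cont_FlP hc] [fD gD hD].
have ker1 : character_kernel 1 by split; exact: character1.
have kerM x y : character_kernel x -> character_kernel y ->
    character_kernel (x * y).
  by move=> [x1 x2 x3] [y1 y2 y3]; split; rewrite characterM ?x1 ?x2 ?x3 add0r.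
have kerV x : character_kernel x -> character_kernel x^-1.
  by move=> [x1 x2 x3]; split; rewrite characterV ?x1 ?x2 ?x3 oppr0.
have add1 u : additive_on_kernel u -> u 1 = 0%R.
  by move=> uD; apply: (addrI (u 1)); rewrite -uD// mulg1 addr0.
have addV u x : additive_on_kernel u -> character_kernel x -> u x = 0%R ->
    u x^-1 = 0%R.
  move=> uD kx ux; apply: (addrI (u x)); rewrite -uD ?mulgV ?add1 ?ux ?addr0//.
  exact: kerV.
split.
- move=> x clx.
  have [y [[[y1 y2 y3] [yf yg yh]] yx]] : common_kernel f g h `&`
      [set y | [/\ c1 y = c1 x, c2 y = c2 x & c3 y = c3 x] /\
               [/\ f y = f x, g y = g x & h y = h x]] !=set0.
    apply: clx; near=> y; split; split; near: y;
      by [exact: character_near|exact: fc|exact: gc|exact: hc].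
  case: yx => -[x1 x2 x3] [xf xg xh].
  by split; split; rewrite -?(x1, x2, x3, xf, xg, xh).
- by split=> //; split; exact: add1.
- move=> x y [kx [fx gx hx]] [ky [fy gy hy]]; split; first exact: kerM.
  by split; rewrite ?fD ?gD ?hD// ?fx ?gx ?hx ?fy ?gy ?hy addr0.
- move=> x [kx [fx gx hx]]; split; first exact: kerV.
  by split; exact: addV.
Unshelve. all: by end_near. Qed.

Lemma additive_on_kernelB f g :
  additive_on_kernel f -> additive_on_kernel g -> additive_on_kernel (f - g)%R.
Proof. by move=> fD gD x y kx ky; rewrite !fctE fD// gD//; ring. Qed.

Lemma lift_additive_on_kernel (k12 k23 k13 : T -> 'F_l) :
  unipotent_lift c1 c2 c3 k12 k23 k13 ->
  [/\ additive_on_kernel k12, additive_on_kernel k23 & additive_on_kernel k13].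
Proof.
move=> [[_ _ M12 M23] _ M13]; split=> x y [x1 x2 x3] [y1 y2 y3].
- by rewrite M12 x1 mul0r addr0.
- by rewrite M23 x2 mul0r addr0.
- by rewrite M13 x1 y3 mul0r mulr0 !addr0.
Qed.

Definition central_image (k12 k23 : T -> 'F_l) : set T :=
  character_kernel `&` [set x | k12 x = 0%R /\ k23 x = 0%R].

(** With [z] the conjugate of [n] by [x], this avoids having to know that the
terms of the series are normal. *)
Lemma central_image_conj (k12 k23 k13 : T -> 'F_l) n x z :
  unipotent_lift c1 c2 c3 k12 k23 k13 -> z * x = x * n ->
  central_image k12 k23 n -> central_image k12 k23 z /\ k13 z = k13 n.
Proof.
move=> [[_ _ M12 M23] _ M13] zx [[n1 n2 n3] [n12 n23]].
have cz (c : character l T) : c n = 0%R -> c z = 0%R.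
  by move=> cn; apply: (addIr (c x)); rewrite -characterM zx characterM cn addrC.
have z1 := cz _ n1; have z2 := cz _ n2; have z3 := cz _ n3.
have z12 : k12 z = 0%R.
  apply: (addIr (k12 x)); have := M12 z x.
  by rewrite zx M12 z1 n2 n12 mul0r mulr0 !addr0 add0r.
have z23 : k23 z = 0%R.
  apply: (addIr (k23 x)); have := M23 z x.
  by rewrite zx M23 z2 n3 n23 mul0r mulr0 !addr0 add0r.
split; first by [].
apply: (addIr (k13 x)); have := M13 z x.
by rewrite zx M13 z1 z12 n3 n23 !mul0r !mulr0 !addr0 => <-; rewrite addrC.
Qed.

Section TwoLifts.
Context {k12 k23 k13 k12' k23' k13' : T -> 'F_l}.
Context (kP : unipotent_lift c1 c2 c3 k12 k23 k13).
Context (kP' : unipotent_lift c1 c2 c3 k12' k23' k13').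

(** The entries next to the superdiagonal are determined by the characters on
commutators, and vanish on [l]-th powers. The third slot has no condition of its
own and repeats the second. *)
Lemma lcs2_sub :
  lcs l 2 `<=` common_kernel (k12 - k12')%R (k23 - k23')%R (k23 - k23')%R.
Proof.
have [[k12c k23c M12 M23] _ _] := kP; have [[k12c' k23c' M12' M23'] _ _] := kP'.
have [k12D k23D _] := lift_additive_on_kernel _ _ _ kP.
have [k12D' k23D' _] := lift_additive_on_kernel _ _ _ kP'.
apply: lcs_next_sub => [|x y _|x _].
- apply: closed_subgroup_common_kernel; split; do ?exact: cont_FlB;
    exact: additive_on_kernelB.
- split; split; rewrite ?character_comm// !fctE.
  + by rewrite (cup_primitive_comm M12) (cup_primitive_comm M12') subrr.
  + by rewrite (cup_primitive_comm M23) (cup_primitive_comm M23') subrr.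
  + by rewrite (cup_primitive_comm M23) (cup_primitive_comm M23') subrr.
- have [cl [x12 x23 _]] := unipotent_lift_expl kP x.
  have [_ [x12' x23' _]] := unipotent_lift_expl kP' x.
  by split=> //; split; rewrite !fctE ?x12 ?x23 ?x12' ?x23' subrr.
Qed.

(** The value of a lift on the third term is central and is independent of the
lift. This uses the agreement of the two lifts on the second term, through
[unipotent_lift_comm]. *)
Lemma lcs3_sub : lcs l 3 `<=` common_kernel k12 k23 (k13 - k13')%R.
Proof.
have [[k12c k23c M12 M23] k13c _] := kP; have [_ k13c' _] := kP'.
have [k12D k23D k13D] := lift_additive_on_kernel _ _ _ kP.
have [_ _ k13D'] := lift_additive_on_kernel _ _ _ kP'.
apply: lcs_next_sub => [|x y /lcs2_sub|x _].
- apply: closed_subgroup_common_kernel; split=> //; first exact: cont_FlB.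
  exact: additive_on_kernelB.
- move=> [[x1 x2 x3] [x12 x23 _]]; split; split; rewrite ?character_comm// ?fctE.
  + by rewrite (cup_primitive_comm M12) x1 x2; ring.
  + by rewrite (cup_primitive_comm M23) x2 x3; ring.
  + rewrite (unipotent_lift_comm kP) (unipotent_lift_comm kP') x1 x2 x3.
    by rewrite (subr0_eq x12) (subr0_eq x23); ring.
- have [cl [x12 x23 x13]] := unipotent_lift_expl kP x.
  have [_ [_ _ x13']] := unipotent_lift_expl kP' x.
  by split=> //; split; rewrite // !fctE x13 x13' subrr.
Qed.

End TwoLifts.

Lemma lcs4_sub (k12 k23 k13 : T -> 'F_l) :
  unipotent_lift c1 c2 c3 k12 k23 k13 -> lcs l 4 `<=` common_kernel k12 k23 k13.
Proof.
move=> kP; have [[k12c k23c M12 M23] k13c _] := kP.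
have [k12D k23D k13D] := lift_additive_on_kernel _ _ _ kP.
apply: lcs_next_sub => [|x y /(lcs3_sub kP kP)|x _].
- exact: closed_subgroup_common_kernel.
- move=> [[x1 x2 x3] [x12 x23 _]]; split; split; rewrite ?character_comm//.
  + by rewrite (cup_primitive_comm M12) x1 x2; ring.
  + by rewrite (cup_primitive_comm M23) x2 x3; ring.
  + by rewrite (unipotent_lift_comm kP) x1 x2 x3 x12 x23; ring.
- by have [cl kl] := unipotent_lift_expl kP x; split.
Qed.

End CentralSeries.

Arguments central_image {l T} c1 c2 c3 k12 k23.

(** * Semidirect products *)

Section Semidirect.
Context {l : nat} {Omega G : groupTopologicalType}.
Context {phi : cont_hom G (cont_aut Omega)}.
Implicit Types (x y : Omega) (g : G).

Definition semi_inl x : semidirect phi := (x, 1).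
Definition semi_inr g : semidirect phi := (1, g).

Lemma semi_inlM x y : semi_inl (x * y) = semi_inl x * semi_inl y.
Proof. by congr pair; rewrite ?hom_morph1 ?mulg1. Qed.

Lemma continuous_semi_inl : continuous semi_inl.
Proof.
by move=> x; apply: cvg_pair; [exact: cvg_id|exact: cvg_cst].
Qed.

(** The action becomes conjugation in the semidirect product, so that [tau3]
becomes a commutator. *)
Lemma semi_comm g x :
  group_comm (semi_inr g) (semi_inl x) = semi_inl (phi g x * x^-1).
Proof.
apply: (mulIg (semi_inl x * semi_inr g)); rewrite group_commK mulgA -semi_inlM.
rewrite mulgKV; congr pair; rewrite /= ?mul1g ?mulg1//.
by rewrite hom_morph1 mulg1.
Qed.

Lemma lcs_next1 (H : set Omega) : lcs_next l H 1.
Proof. by move=> K [[]]. Qed.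

Lemma lcs_kernel3_mul g x : lcs_kernel l phi 3 g ->
  exists2 n, lcs l 3 n & phi g x = x * n.
Proof.
move=> /(_ x) E.
have : coset_mod (lcs l 3) (phi g x) (phi g x).
  by exists 1; [exact: lcs_next1|rewrite mulg1].
by rewrite E => -[n n3 <-]; exists n.
Qed.

Context {c1 c2 c3 : character l Omega}.

Lemma unipotent_lift_restrict (chi1 chi2 chi3 : character l (semidirect phi))
    (k12 k23 k13 : semidirect phi -> 'F_l) :
  extends chi1 c1 -> extends chi2 c2 -> extends chi3 c3 ->
  unipotent_lift chi1 chi2 chi3 k12 k23 k13 ->
  unipotent_lift c1 c2 c3 (k12 \o semi_inl) (k23 \o semi_inl) (k13 \o semi_inl).
Proof.
move=> e1 e2 e3 [[k12c k23c M12 M23] k13c M13].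
have comp (k : semidirect phi -> 'F_l) : cont_Fl k -> cont_Fl (k \o semi_inl).
  move=> kc x.
  exact: (continuous_comp (continuous_semi_inl x) (kc (semi_inl x))).
split; [split|..]; do ?exact: comp; move=> x y /=;
  by rewrite semi_inlM ?M12 ?M23 ?M13 -?e1 -?e2 -?e3.
Qed.

Lemma cont_Fl_inflate (k : Omega -> 'F_l) :
  cont_Fl k -> cont_Fl (fun w : semidirect phi => k w.1).
Proof.
move=> /cont_FlP kc; apply/cont_FlP => -[x g].
exact: (@cvg_fst _ _ (nbhs x) (nbhs g) _ _ (kc x)).
Qed.

Definition inflate (c : character l Omega)
    (cinv : forall g x, c (phi g x) = c x) :
  character l (semidirect phi).
Proof.
exists (fun w => c w.1); first exact/cont_Fl_inflate/character_cont.
by move=> [x g] [y h]; rewrite /= characterM cinv.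
Defined.

Lemma central_quotient_lift_inflate (k12 k23 : Omega -> 'F_l)
    (inv1 : forall g x, c1 (phi g x) = c1 x)
    (inv2 : forall g x, c2 (phi g x) = c2 x)
    (inv3 : forall g x, c3 (phi g x) = c3 x) :
  (forall g x, k12 (phi g x) = k12 x) -> (forall g x, k23 (phi g x) = k23 x) ->
  central_quotient_lift c1 c2 c3 k12 k23 ->
  central_quotient_lift (inflate c1 inv1) (inflate c2 inv2) (inflate c3 inv3)
    (fun w => k12 w.1) (fun w => k23 w.1).
Proof.
move=> inv12 inv23 [k12c k23c M12 M23].
split; do ?exact: cont_Fl_inflate; move=> [x g] [y h] /=.
- by rewrite M12 inv12 inv2.
- by rewrite M23 inv23 inv3.
Qed.

End Semidirect.

(** * The triple Massey product of a semidirect product *)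

Section Main.
Context {l : nat} (l_prime : prime l) (l_gt3 : (3 < l)%N).

Lemma massey_rho_lift {T : groupTopologicalType} {c1 c2 c3 : character l T} :
  massey c1 c2 c3 0%R ->
  unipotent_lift c1 c2 c3 (fun x => entry (massey_rho c1 c2 c3 x) 0 2)
    (fun x => entry (massey_rho c1 c2 c3 x) 1 3) (h_l c1 c2 c3).
Proof. by move=> /massey0_lift ex; apply: U4_lift_coords; exact: xgetPex. Qed.

(** The hypotheses are the vanishing of the entries (1, 3) and (2, 4) of the
commutator of a matrix with superdiagonal [a1, a2, a3] and the values of a lift
of [c1, c2, c3]. Independence of one pair kills two of the [ai]; as [c2] is not
zero, the other relation kills the third. *)
Lemma minors_eq0 {T : groupTopologicalType} {c1 c2 c3 : character l T}
    (a1 a2 a3 : 'F_l) :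
  (exists x, c2 x <> 0%R) ->
  lin_indep2 c1 c2 \/ lin_indep2 c2 c3 ->
  (forall x, a1 * c2 x - c1 x * a2 = 0)%R ->
  (forall x, a2 * c3 x - c2 x * a3 = 0)%R ->
  [/\ a1 = 0%R, a2 = 0%R & a3 = 0%R].
Proof.
move=> [x2 /eqP c2x].
have indep (c d : character l T) (a b : 'F_l) : lin_indep2 c d ->
    (forall x, a * d x - c x * b = 0)%R -> a = 0%R /\ b = 0%R.
  move=> cd E; have [] := cd (- b)%R a; last by move/eqP; rewrite oppr_eq0 => /eqP.
  by move=> x; rewrite -(E x); ring.
case=> ind E1 E2.
  have [a1_0 a2_0] := indep _ _ _ _ ind E1; split=> //.
  have /eqP := E2 x2; rewrite a2_0 mul0r sub0r oppr_eq0 mulf_eq0 (negbTE c2x).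
  by move/eqP.
have [a2_0 a3_0] := indep _ _ _ _ ind E2; split=> //.
have /eqP := E1 x2; rewrite a2_0 mulr0 subr0 mulf_eq0 (negbTE c2x) orbF.
by move/eqP.
Qed.

(** The value of [h_l] on the coset [tau3 g x0] is the (1, 4) entry of a
commutator whose two factors have zero superdiagonal. *)
Lemma tau3_obstruction {Omega G : groupTopologicalType}
    {phi : cont_hom G (cont_aut Omega)} {c1 c2 c3 : character l Omega}
    (chi1 chi2 chi3 : character l (semidirect phi)) (g : G) (x0 : Omega) :
  massey c1 c2 c3 0%R ->
  (exists x, c2 x <> 0%R) -> lin_indep2 c1 c2 \/ lin_indep2 c2 c3 ->
  lcs_kernel l phi 3 g -> [/\ c1 x0 = 0%R, c2 x0 = 0%R & c3 x0 = 0%R] ->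
  extends chi1 c1 -> extends chi2 c2 -> extends chi3 c3 ->
  massey chi1 chi2 chi3 0%R -> h_l_coset c1 c2 c3 (tau3 l phi g x0) = 0%R.
Proof.
move=> c0 c2_neq0 c_indep g3 [x1 x2 x3] e1 e2 e3 chi0.
have hP := massey_rho_lift c0; have kP := massey_rho_lift chi0.
set k12 := (fun x => entry _ 0 2) in kP.
set k23 := (fun x => entry _ 1 3) in kP.
set k13 := h_l _ _ _ in kP.
have rP := unipotent_lift_restrict _ _ _ _ _ _ e1 e2 e3 kP.
have inC (x : Omega) : exists n, [/\ lcs l 3 n, phi g x * x^-1 * x = x * n,
    central_image c1 c2 c3 (k12 \o semi_inl) (k23 \o semi_inl)
      (phi g x * x^-1) & k13 (semi_inl (phi g x * x^-1)) = k13 (semi_inl n)].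
  have [n n3 E] := lcs_kernel3_mul g x g3; exists n.
  have zx : phi g x * x^-1 * x = x * n by rewrite mulgKV.
  have [cn [n12 n23 _]] := lcs3_sub l_prime l_gt3 rP rP n n3.
  by have [] := central_image_conj _ _ _ _ _ _ rP zx (conj cn (conj n12 n23)).
have [M12 M23] := (k12M (lift_quotient kP), k23M (lift_quotient kP)).
have [a1 a2 a3] : [/\ chi1 (semi_inr g) = 0%R, chi2 (semi_inr g) = 0%R
    & chi3 (semi_inr g) = 0%R].
  apply: minors_eq0 c2_neq0 c_indep _ _ => x.
  - have [n [_ _ [_ [/= z12 _]] _]] := inC x.
    by rewrite -z12 -semi_comm (cup_primitive_comm M12) e1 e2.
  - have [n [_ _ [_ [/= _ z23]] _]] := inC x.
    by rewrite -z23 -semi_comm (cup_primitive_comm M23) e2 e3.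
have [n [n3 zx _ zn]] := inC x0.
(* Both lifts agree on the third term, so [h_l] can be computed with [k13]. *)
have hz : h_l c1 c2 c3 n = 0%R.
  have [_ [_ _ /eqP]] := lcs3_sub l_prime l_gt3 hP rP n n3.
  rewrite !fctE subr_eq0 => /eqP ->; rewrite /= -zn -semi_comm.
  by rewrite (unipotent_lift_comm kP) e1 e2 e3 x1 x2 x3 a1 a2 a3; ring.
(* The representative chosen in the coset is off by an [m] of the fourth term. *)
rewrite /h_l_coset; have : tau3 l phi g x0 (xget 1 (tau3 l phi g x0)).
  apply: xgetPex; exists (phi g x0 * x0^-1), 1; first exact: lcs_next1.
  by rewrite mulg1.
case=> m m4 <-.
have [cn [n12 n23 _]] := lcs3_sub l_prime l_gt3 hP hP n n3.
have [[[z1 _ _] [z12 _]] hzn] :=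
  central_image_conj _ _ _ _ _ _ hP zx (conj cn (conj n12 n23)).
have [[_ _ m3] [_ _ hm]] := lcs4_sub l_prime l_gt3 _ _ _ hP m m4.
by rewrite (k13M hP) hzn hz hm z1 m3 mul0r mulr0 !addr0.
Qed.

Lemma inflated_massey_nonempty {Omega G : groupTopologicalType}
    {phi : cont_hom G (cont_aut Omega)} {c1 c2 c3 : character l Omega} :
  massey c1 c2 c3 0%R -> lcs_kernel l phi 3 = [set: G] ->
  exists chi1 chi2 chi3 : character l (semidirect phi),
     [/\ extends chi1 c1, extends chi2 c2, extends chi3 c3
       & massey chi1 chi2 chi3 !=set0].
Proof.
move=> c0 G3; have hP := massey_rho_lift c0.
set k12 := (fun x => entry _ 0 2) in hP.
set k23 := (fun x => entry _ 1 3) in hP.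
have [M12 M23] := (k12M (lift_quotient hP), k23M (lift_quotient hP)).
have phiE g x : exists n, [/\ phi g x = x * n, c1 n = 0%R, c2 n = 0%R,
    c3 n = 0%R & k12 n = 0%R /\ k23 n = 0%R].
  have [|n n3 E] := @lcs_kernel3_mul l _ _ phi g x; first by rewrite G3.
  have [[n1 n2 n3'] [n12 n23 _]] := lcs3_sub l_prime l_gt3 hP hP n n3.
  by exists n.
have inv1 g x : c1 (phi g x) = c1 x.
  by have [n [-> n1 _ _ _]] := phiE g x; rewrite characterM n1 addr0.
have inv2 g x : c2 (phi g x) = c2 x.
  by have [n [-> _ n2 _ _]] := phiE g x; rewrite characterM n2 addr0.
have inv3 g x : c3 (phi g x) = c3 x.
  by have [n [-> _ _ n3 _]] := phiE g x; rewrite characterM n3 addr0.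
have inv12 g x : k12 (phi g x) = k12 x.
  by have [n [-> _ n2 _ [n12 _]]] := phiE g x; rewrite M12 n12 n2 mulr0 !addr0.
have inv23 g x : k23 (phi g x) = k23 x.
  by have [n [-> _ _ n3 [_ n23]]] := phiE g x; rewrite M23 n23 n3 mulr0 !addr0.
exists (inflate c1 inv1), (inflate c2 inv2), (inflate c3 inv3); split=> //.
apply: massey_nonempty.
exact: central_quotient_lift_inflate inv12 inv23 (lift_quotient hP).
Qed.

End Main.

Theorem proposition2p10 (l : nat) (l_prime : prime l) (l_gt3 : 3 < l)
  (Omega G : groupTopologicalType)
  (OmegaG : abstract_group Omega /\ abstract_group G \/ profinite Omega /\ profinite G)
  (phi : cont_hom G (cont_aut Omega))
  (c1 c2 c3 : character l Omega)
  (c_massey : massey c1 c2 c3 !=set0 /\ massey c1 c2 c3 0%R)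
  (c_neq0 : [/\ exists x, c1 x <> 0%R, exists x, c2 x <> 0%R
              & exists x, c3 x <> 0%R])
  (c_indep : lin_indep2 c1 c2 \/ lin_indep2 c2 c3)
  (c_tau : exists (g : G) (x0 : Omega), lcs_kernel l phi 3 g /\
     [/\ c1 x0 = 0%R, c2 x0 = 0%R, c3 x0 = 0%R
       & h_l_coset c1 c2 c3 (tau3 l phi g x0) <> 0%R]) :
  (forall chi1 chi2 chi3 : character l (semidirect phi),
     extends chi1 c1 -> extends chi2 c2 -> extends chi3 c3 ->
     massey chi1 chi2 chi3 !=set0 -> ~ massey chi1 chi2 chi3 0%R) /\
  (lcs_kernel l phi 3 = [set: G] ->
   exists chi1 chi2 chi3 : character l (semidirect phi),
     [/\ extends chi1 c1, extends chi2 c2, extends chi3 c3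
       & massey chi1 chi2 chi3 !=set0]).
Proof.
have [_ c0] := c_massey; have [_ c2_neq0 _] := c_neq0.
split; last exact: inflated_massey_nonempty.
move=> chi1 chi2 chi3 e1 e2 e3 _ chi0.
have [g [x0 [g3 [x1 x2 x3 tau_neq0]]]] := c_tau; apply: tau_neq0.
exact: (tau3_obstruction l_prime l_gt3 chi1 chi2 chi3).
Qed.
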